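(* Let $M\in\mathbb{R}^{d\times d}$ be symmetric positive definite, let $S\in\mathbb{R}^{d\times d}$ be constant with $S^\top=-S$ or $S\preceq0$, let $V:\mathbb{R}^d\to\mathbb{R}$ be differentiable, and let $C>0$ be a constant with $V(z)+C>0$ for all $z\in\mathbb{R}^d$. For $\tilde z=[z^\top,r]^\top\in\mathbb{R}^{d+1}$ set $$\tilde S(\tilde z)=\begin{bmatrix} S & \dfrac{S\nabla V(z)}{2\sqrt{V(z)+C}}\\[2mm] \dfrac{\nabla V(z)^\top S}{2\sqrt{V(z)+C}} & \dfrac{\nabla V(z)^\top S\nabla V(z)}{4(V(z)+C)}\end{bmatrix},\qquad \tilde H(\tilde z)=\tfrac12 z^\top Mz+r^2-C .$$ Then along every solution $\tilde z(t)$ of the extended system $\dot{\tilde z}=\tilde S(\tilde z)\nabla\tilde H(\tilde z)$, $$\frac{d}{dt}\tilde H(\tilde z(t))=0\ \text{ if } S^\top=-S,\qquad \frac{d}{dt}\tilde H(\tilde z(t))\le 0\ \text{ if } S\preceq 0 .$$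
   Context: $S\preceq0$ means that $\operatorname{sym}(S)=\tfrac12(S+S^\top)$ is negative semidefinite ($S$ need not be symmetric). The extended system is the scalar auxiliary variable (SAV) reformulation of $\dot z=S\nabla H(z)$ with $H(z)=\tfrac12 z^\top Mz+V(z)$, where $r$ represents $\sqrt{V(z)+C}$. The gradient $\nabla\tilde H$ is taken with respect to the extended variable $\tilde z=(z,r)$, so $\nabla\tilde H(\tilde z)=[(Mz)^\top,2r]^\top$. *)

(* Defs.v *)
From HB Require Import structures.
From mathcomp Require Import all_boot all_order all_algebra.
From mathcomp Require Import all_classical all_reals all_analysis.
Import Order.TTheory GRing.Theory Num.Theory.
Import numFieldNormedType.Exports.

Set Implicit Arguments.
Unset Strict Implicit.
Unset Printing Implicit Defensive.

Local Open Scope classical_set_scope.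
Local Open Scope ring_scope.

Definition quad_form (R : realType) (n : nat) (A : 'M[R]_n) (x : 'cV[R]_n) : R :=
  (x^T *m A *m x) ord0 ord0.

Definition sympart (R : realType) (n : nat) (A : 'M[R]_n) : 'M[R]_n :=
  2^-1 *: (A + A^T).

Definition sym_posdef (R : realType) (n : nat) (A : 'M[R]_n) : Prop :=
  A^T = A /\ forall x : 'cV[R]_n, x != 0 -> 0 < quad_form A x.

Definition sym_negsemidef (R : realType) (n : nat) (A : 'M[R]_n) : Prop :=
  A^T = A /\ forall x : 'cV[R]_n, quad_form A x <= 0.

(* The relation S <= 0 for a matrix S that need not be symmetric. *)
Definition mx_le0 (R : realType) (n : nat) (S : 'M[R]_n) : Prop :=
  sym_negsemidef (sympart S).

Definition grad (R : realType) (n : nat) (f : 'cV[R]_n -> R) (x : 'cV[R]_n) :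
    'cV[R]_n :=
  \col_i 'D_(delta_mx i ord0) f x.

(* [l] is the derivative of [f] at [t] relative to [I]: one-sided at an
   endpoint of [I] that belongs to [I], and the usual derivative at an interior
   point (see [is_derive_inP]). *)
Definition is_derive_in (R : realType) (W : normedModType R) (I : set R)
    (f : R -> W) (t : R) (l : W) : Prop :=
  (s - t)^-1 *: (f s - f t) @[s --> within I t^'] --> l.

Lemma is_derive_inP (R : realType) (W : normedModType R) (I : set R)
    (f : R -> W) (t : R) (l : W) :
  I° t -> is_derive_in I f t l <-> is_derive t 1 f l.
Proof.
move=> It; have -> : is_derive_in I f t l <->
    (s - t)^-1 *: (f s - f t) @[s --> t^'] --> l.
  rewrite /is_derive_in; suff -> : within I t^' = t^' by [].
  apply/funext => P; apply/propext; rewrite /within /dnbhs /=; split.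
    by move=> H; apply: filterS2 It H => s Is + snt; apply.
  by move=> H; apply: filterS H => s Hs snt; exact: Hs.
have -> : ((s - t)^-1 *: (f s - f t) @[s --> t^']) =
    (fun h : R => h^-1 *: ((f \o shift t) (h *: (1 : R)) - f t)) @ 0^'.
  apply/funext => P; apply/propext.
  have := near_shift (0 : R) t
    (fun s : R => s != t -> P ((s - t)^-1 *: (f s - f t))).
  rewrite subr0 => E; change (
    (\forall s \near t, s != t -> P ((s - t)^-1 *: (f s - f t))) <->
    (\forall h \near (0 : R),
       h != 0 -> P (h^-1 *: (f (h *: (1 : R) + t) - f t)))).
  rewrite E; suff -> : (fun s : R => s != t ->
       P ((s - t)^-1 *: (f s - f t))) \o shift t =
     (fun h : R => h != 0 -> P (h^-1 *: (f (h *: (1 : R) + t) - f t))) by [].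
  by apply/funext => h /=; rewrite addrK -subr_eq0 addrK [_ *: 1]mulr1.
split=> [H|[df <-]]; last exact: df.
split; first exact: (cvgP _ H).
exact: (cvg_lim (@norm_hausdorff _ _) H).
Qed.

(* For an extended state x = (z, r), [usubmx x] is z and [sav_aux x] is r. *)
Definition sav_aux (R : realType) (d : nat) (x : 'cV[R]_(d + 1)) : R :=
  dsubmx x ord0 ord0.

Definition sav_S (R : realType) (d : nat) (S : 'M[R]_d) (V : 'cV[R]_d -> R)
    (C : R) (x : 'cV[R]_(d + 1)) : 'M[R]_(d + 1) :=
  let z := usubmx x in
  let g := grad V z in
  block_mx
    S
    ((2 * Num.sqrt (V z + C))^-1 *: (S *m g))
    ((2 * Num.sqrt (V z + C))^-1 *: (g^T *m S))
    ((4 * (V z + C))^-1 *: (g^T *m S *m g)).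

Definition sav_H (R : realType) (d : nat) (M : 'M[R]_d) (C : R)
    (x : 'cV[R]_(d + 1)) : R :=
  2^-1 * quad_form M (usubmx x) + sav_aux x ^+ 2 - C.

Definition sav_solution (R : realType) (d : nat) (M S : 'M[R]_d)
    (V : 'cV[R]_d -> R) (C : R) (I : interval R) (x : R -> 'cV[R]_(d + 1)) :
    Prop :=
  forall t : R, t \in I ->
    is_derive_in [set` I] x t (sav_S S V C (x t) *m grad (sav_H M C) (x t)).

(* Main.v *)
Require Import Defs.
From HB Require Import structures.
From mathcomp Require Import all_boot all_order all_algebra.
From mathcomp Require Import all_classical all_reals all_analysis.
From mathcomp Require Import ring.
Import Order.TTheory GRing.Theory Num.Theory.
Import numFieldNormedType.Exports.
Set Implicit Arguments.
Unset Strict Implicit.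

Local Open Scope classical_set_scope.
Local Open Scope ring_scope.

(** The energy is a quadratic form plus a constant, [sav_H M C x = x^T B x - C]
    with [B = diag (M / 2, 1)] symmetric ([sav_HE]), so its gradient is
    [2 B x] ([grad_sav_H]) and along a differentiable curve its derivative
    is [x'^T (2 B x) = x'^T (grad H x)].  The structure matrix is a congruence
    transform of [S]: with [q = 1 / (2 sqrt (V z + C))] and
    [L = [1; q (grad V z)^T]], one has [sav_S x = L S L^T] ([sav_S_congr]).
    Hence along a solution [dH/dt = (L^T grad H)^T S (L^T grad H)], a value of
    the quadratic form of [S], which vanishes if [S] is skew-symmetric and is
    nonpositive if the symmetric part of [S] is negative semidefinite.

    The gradient and the chain rule both come from [cvg_quad_form_quotient],
    the exact expansion [Q (x + e w) = Q x + e (2 w^T B x) + e^2 Q w] passed to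
    the limit [e -> 0], [w -> l] along an arbitrary filter; this covers
    one-sided derivatives at the endpoints of the interval. *)

Section QuadForm.
Variables (R : realType) (n : nat).
Implicit Types (A : 'M[R]_n) (u v x l : 'cV[R]_n).

Lemma quad_form_tr A x : quad_form A^T x = quad_form A x.
Proof.
by rewrite /quad_form -[in RHS](trmxK (_ *m x)) [RHS]mxE !trmx_mul trmxK mulmxA.
Qed.

Lemma quad_form_sympart A x : quad_form (sympart A) x = quad_form A x.
Proof.
have := quad_form_tr A x; rewrite /quad_form /sympart => trE.
rewrite -scalemxAr -scalemxAl mulmxDr mulmxDl !mxE.
move: trE; rewrite !mxE => ->.
by rewrite -mulr2n -[X in _ * X]mulr_natl mulKf// pnatr_eq0.
Qed.

Lemma quad_form_skew A x : A^T = - A -> quad_form A x = 0.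
Proof.
(* The value equals its own opposite. *)
move=> A_skew; have := quad_form_tr A x.
rewrite A_skew /quad_form mulmxN mulNmx mxE => /eqP.
by rewrite eq_sym -addr_eq0 -mulr2n mulrn_eq0 => /eqP.
Qed.

(** Congruence: the value of [L A L^T] at [x] is that of [A] at [L^T x]. *)
Lemma quad_form_congr m (L : 'M[R]_(m, n)) A (x : 'cV[R]_m) :
  quad_form (L *m A *m L^T) x = quad_form A (L^T *m x).
Proof. by rewrite /quad_form trmx_mul trmxK !mulmxA. Qed.

Lemma quad_formDZ A x (e : R) v : A^T = A ->
  quad_form A (x + e *: v) =
    quad_form A x + e * ((2 * (v^T *m A *m x) ord0 ord0) + e * quad_form A v).
Proof.
move=> A_sym.
have cross : (x^T *m A *m v) ord0 ord0 = (v^T *m A *m x) ord0 ord0.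
  by rewrite -[in RHS](trmxK (_ *m x)) [RHS]mxE !trmx_mul trmxK A_sym mulmxA.
rewrite /quad_form [(x + _)^T]linearD/= [(e *: v)^T]linearZ/=.
rewrite !mulmxDl !mulmxDr -?scalemxAr -?scalemxAl -?scalemxAr.
move: (x^T *m A *m v) (v^T *m A *m x) (x^T *m A *m x) (v^T *m A *m v) cross.
by move=> xv vx xx vv xvE; rewrite !mxE xvE; ring.
Qed.

Lemma cvg_bilinear A (T : Type) (F : set_system T) {FF : Filter F}
    (f g : T -> 'cV[R]_n) u v :
  f @ F --> u -> g @ F --> v ->
  ((f s)^T *m A *m g s) ord0 ord0 @[s --> F] --> (u^T *m A *m v) ord0 ord0.
Proof.
move=> fu gv.
have coord (h : T -> 'cV[R]_n) (w : 'cV[R]_n) i :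
    h @ F --> w -> h s i ord0 @[s --> F] --> w i ord0.
  by move=> hw; exact: (cvg_comp _ _ hw (@coord_continuous _ _ _ i ord0 w)).
have -> : (fun s => ((f s)^T *m A *m g s) ord0 ord0) =
    (fun s => \sum_j (\sum_i f s i ord0 * A i j) * g s j ord0).
  apply/funext => s; rewrite mxE; apply: eq_bigr => j _; rewrite mxE.
  by congr (_ * _); apply: eq_bigr => i _; rewrite mxE.
have -> : (u^T *m A *m v) ord0 ord0 =
    \sum_j (\sum_i u i ord0 * A i j) * v j ord0.
  rewrite mxE; apply: eq_bigr => j _; rewrite mxE.
  by congr (_ * _); apply: eq_bigr => i _; rewrite mxE.
apply: cvg_big => [|j _]; first exact: add_continuous.
apply: cvgM; last exact: coord.
apply: cvg_big => [|i _]; first exact: add_continuous.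
by apply: cvgM; [exact: coord|exact: cvg_cst].
Qed.

(** Hadamard differentiability of a quadratic form, along any filter: the
    directions [w s] may vary, as long as they converge to [l].  The filter need
    not be proper, so an isolated point of an interval is not an exception. *)
Lemma cvg_quad_form_quotient A x (T : Type) (F : set_system T) {FF : Filter F}
    (e : T -> R) (w : T -> 'cV[R]_n) l :
  A^T = A -> (\forall s \near F, e s != 0) ->
  e @ F --> (0 : R) -> w @ F --> l ->
  (e s)^-1 *: (quad_form A (x + e s *: w s) - quad_form A x) @[s --> F] -->
    2 * (l^T *m A *m x) ord0 ord0.
Proof.
move=> A_sym e_neq0 e0 wl.
have lim : 2 * ((w s)^T *m A *m x) ord0 ord0 + e s * quad_form A (w s)
    @[s --> F] --> 2 * (l^T *m A *m x) ord0 ord0.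
  rewrite -[X in _ --> X]addr0 -(mul0r (quad_form A l)).
  apply: cvgD; apply: cvgM => //; first exact: cvg_cst.
  - by apply: cvg_bilinear => //; exact: cvg_cst.
  - exact: cvg_bilinear.
apply: cvg_trans lim; apply: near_eq_cvg.
apply: filterS e_neq0 => s es0.
by rewrite quad_formDZ// addrAC subrr add0r [_ *: _]mulKf.
Qed.

Lemma grad_quad_formD A (c : R) x :
  A^T = A -> grad (fun y => quad_form A y + c) x = 2 *: (A *m x).
Proof.
move=> A_sym; apply/colP => i; rewrite !mxE.
have -> : \sum_j A i j * x j ord0 =
    ((delta_mx i ord0 : 'cV[R]_n)^T *m A *m x) ord0 ord0.
  by rewrite trmx_delta -rowE -row_mul !mxE.
apply: cvg_lim; first exact: norm_hausdorff.
(* The direction is constantly the basis vector and the step is [h] itself. *)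
have := @cvg_quad_form_quotient A x _ (0 : R)^' _ id
  (fun=> delta_mx i ord0) (delta_mx i ord0) A_sym.
move=> /(_ _ (nbhs_dnbhs_neq _) (nbhs_dnbhs (x := _)) (cvg_cst _)).
apply: cvg_trans; apply: near_eq_cvg; apply: nearW => h /=.
by rewrite opprD addrACA subrr addr0 (addrC x).
Qed.

(** Chain rule for a quadratic form along a curve, relative to [I]. *)
Lemma is_derive_in_quad_formD A (c : R) (I : set R) (x : R -> 'cV[R]_n) t l :
  A^T = A -> is_derive_in I x t l ->
  is_derive_in I (fun s => quad_form A (x s) + c) t
    (2 * (l^T *m A *m x t) ord0 ord0).
Proof.
move=> A_sym xl; rewrite /is_derive_in.
have neq_t : \forall s \near within I t^', s - t != 0.
  apply: cvg_within; have := nbhs_dnbhs_neq t.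
  by apply: filterS => s; rewrite subr_eq0.
have dt0 : (s - t) @[s --> within I t^'] --> (0 : R).
  apply: cvg_within_filter; apply: cvg_trans; last first.
    have : (s - t) @[s --> t] --> t - t.
      by apply: cvgB; [exact: cvg_id|exact: cvg_cst].
    by rewrite subrr; apply.
  by apply: cvg_app; exact: nbhs_dnbhs.
(* With step [s - t] and the difference quotient of [x] as direction, the
   displaced point [x t + (s - t) *: w s] is [x s]. *)
have := @cvg_quad_form_quotient _ (x t) _ _ _ _ _ _ A_sym neq_t dt0 xl.
move=> /(_ _); apply: cvg_trans; apply: near_eq_cvg.
apply: filterS neq_t => s st0.
by rewrite scalerA divff// scale1r subrKC opprD addrACA subrr addr0.
Qed.

End QuadForm.

Section SAV.
Variables (R : realType) (d : nat).
Implicit Types (M S : 'M[R]_d) (C : R) (x : 'cV[R]_(d + 1)).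

(** Half the Hessian of the energy, [diag (M / 2, 1)]. *)
Definition sav_half_hess M : 'M[R]_(d + 1) := block_mx (2^-1 *: M) 0 0 1%:M.

Lemma tr_sav_half_hess M : M^T = M -> (sav_half_hess M)^T = sav_half_hess M.
Proof.
by move=> M_sym; rewrite /sav_half_hess tr_block_mx !trmx0 trmx1 linearZ/= M_sym.
Qed.

Lemma sav_HE M C x : sav_H M C x = quad_form (sav_half_hess M) x - C.
Proof.
rewrite /sav_H /sav_aux /sav_half_hess /quad_form; congr (_ - _).
rewrite -[x in RHS]vsubmxK tr_col_mx mul_row_block mul_row_col.
rewrite !mulmx0 addr0 add0r mulmx1 -scalemxAr -scalemxAl.
rewrite [RHS]mxE [X in _ = X + _]mxE; congr (_ + _).
by rewrite [RHS]mxE big_ord1 [X in _ = X * _]mxE expr2.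
Qed.

Lemma grad_sav_H M C x :
  M^T = M -> grad (sav_H M C) x = 2 *: (sav_half_hess M *m x).
Proof.
move=> M_sym; rewrite (_ : sav_H M C = fun y => quad_form (sav_half_hess M) y - C).
  by rewrite grad_quad_formD// tr_sav_half_hess.
by apply/funext => y; rewrite sav_HE.
Qed.

(** The factor [L = [1; g^T / (2 sqrt (V z + C))]], with [g] the gradient of
    [V] at [z], of the congruence [sav_S x = L S L^T]. *)
Definition sav_factor (V : 'cV[R]_d -> R) C x : 'M[R]_(d + 1, d) :=
  let z := usubmx x in
  col_mx 1%:M ((2 * Num.sqrt (V z + C))^-1 *: (grad V z)^T).

Lemma sav_S_congr S (V : 'cV[R]_d -> R) C x : 0 < V (usubmx x) + C ->
  sav_S S V C x = sav_factor V C x *m S *m (sav_factor V C x)^T.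
Proof.
move=> VC_gt0; rewrite /sav_S /sav_factor /= tr_col_mx trmx1.
rewrite linearZ/= trmxK mul_col_mx mul1mx mul_col_row !mulmx1.
rewrite -!scalemxAr -!scalemxAl scalerA.
congr (block_mx _ _ _ (_ *: _)).
by rewrite -invfM -[in LHS](sqr_sqrtr (ltW VC_gt0)); congr (_^-1); ring.
Qed.

(** Energy balance: the chain rule gives the rate [l^T (grad H)] with
    [l = (L S L^T) (grad H)].  Along a solution it is therefore the value of
    the quadratic form of [S] at [L^T (grad H)]. *)
Lemma is_derive_in_sav_H M S (V : 'cV[R]_d -> R) C (I : set R)
    (x : R -> 'cV[R]_(d + 1)) t :
  M^T = M -> 0 < V (usubmx (x t)) + C ->
  is_derive_in I x t (sav_S S V C (x t) *m grad (sav_H M C) (x t)) ->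
  is_derive_in I (fun s => sav_H M C (x s)) t
    (quad_form S ((sav_factor V C (x t))^T *m grad (sav_H M C) (x t))).
Proof.
move=> M_sym VC_gt0 /(is_derive_in_quad_formD (- C) (tr_sav_half_hess M_sym)).
have -> : (fun s => quad_form (sav_half_hess M) (x s) - C) =
    (fun s => sav_H M C (x s)) by apply/funext => s; rewrite sav_HE.
congr (is_derive_in _ _ _ _).
rewrite -quad_form_congr -sav_S_congr// -[RHS]quad_form_tr /quad_form.
rewrite -trmx_mul; set l := sav_S _ _ _ _ *m _.
by rewrite grad_sav_H// -scalemxAr mulmxA [RHS]mxE.
Qed.

End SAV.

Theorem proposition1 (R : realType) (d : nat) (M S : 'M[R]_d)
    (V : 'cV[R]_d -> R) (C : R)
    (M_spd : sym_posdef M)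
    (S_cond : S^T = - S \/ mx_le0 S)
    (V_diff : forall z : 'cV[R]_d, differentiable V z)
    (C_gt0 : 0 < C)
    (VC_gt0 : forall z : 'cV[R]_d, 0 < V z + C)
    (I : interval R) (x : R -> 'cV[R]_(d + 1))
    (x_sol : sav_solution M S V C I x) :
  (S^T = - S ->
     forall t : R, t \in I ->
       is_derive_in [set` I] (fun s : R => sav_H M C (x s)) t 0) /\
  (mx_le0 S ->
     forall t : R, t \in I ->
       exists2 l : R,
         is_derive_in [set` I] (fun s : R => sav_H M C (x s)) t l & l <= 0).
Proof.
have balance t (tI : t \in I) :=
  is_derive_in_sav_H M_spd.1 (VC_gt0 (usubmx (x t))) (x_sol t tI).
split=> [S_skew|[_ S_le0]] t tI.
  by have := balance t tI; rewrite quad_form_skew.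
exists (quad_form S ((sav_factor V C (x t))^T *m grad (sav_H M C) (x t))).
  exact: balance.
by rewrite -quad_form_sympart.
Qed.
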